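(* Let $\sigma$ be a triangulation of a polygon with $n\ge3$ vertices and $\Gamma_\sigma$ its frozen Jacobian algebra. (1) For all vertices $i,j$ of $Q_\sigma$ there is a path $w_0(i,j)$ from $i$ to $j$ of minimal $\theta$-length such that every path $w$ from $i$ to $j$ satisfies $w=w_0(i,j)C^N$ in $\Gamma_\sigma$ for some integer $N\ge0$. (2) Writing $\ell^\theta_{i,j}=\ell^\theta(w_0(i,j))$, one has $\ell^\theta_{i,j}=\max_{k\in F}\{\ell^\theta_{k,j}-\ell^\theta_{k,i}\}$ for all vertices $i,j$.
   Context: $K$ a field. $P$ is a regular polygon with vertices $P_1,\dots,P_n$ counterclockwise, so each interior angle is $(n-2)\pi/n$; $\sigma$ is a triangulation (maximal set of non-crossing diagonals), all of whose triangle angles are multiples of $\pi/n$. $Q_\sigma$: vertices = edges of $\sigma$ (sides of $P$ and diagonals); internal arrow $a\to b$ when $a,b$ are sides of a common triangle and $a$ precedes $b$ anticlockwise around their common vertex; external arrow $a\to b$ between the two sides of $P$ at each polygon vertex incident to a diagonal, $a$ preceding $b$ anticlockwise. Minimal cycles: cyclic triangles (three internal arrows in a triangle) and big cycles (internal arrows plus one external arrow around a vertex of $P$). $W_\sigma=\sum$cyclic triangles$-\sum$big cycles; $F$ = vertices given by sides of $P$; $\Gamma_\sigma=KQ_\sigma/J$, $J$ generated by the cyclic derivatives $\partial_aW_\sigma$ ($\partial_a(a_1\cdots a_d)=\sum_{a_i=a}a_{i+1}\cdots a_da_1\cdots a_{i-1}$) for arrows $a$ with source or target not in $F$. All minimal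 cycles through a vertex $i$ (as cycles at $i$) are equal in $\Gamma_\sigma$; their class is $C_i$, and $C=\sum_iC_i$. The $\theta$-length of an internal arrow $i\to j$ is $t$ if the angle between edges $i$ and $j$ in their common triangle is $t\pi/n$; the $\theta$-length of an external arrow is $2$; $\ell^\theta$ is extended additively to paths. *)

(* Defs.v *)
From HB Require Import structures.
From mathcomp Require Import all_boot all_order all_algebra.
Set Implicit Arguments. Unset Strict Implicit. Unset Printing Implicit Defensive.
Import Order.TTheory GRing.Theory Num.Theory.

Section Polygon.
Variable n : nat.

(* Polygon vertices are 'I_n, numbered counterclockwise; ordS / ord_pred are
   the cyclic successor / predecessor. *)
Definition cdist (x y : 'I_n) : nat := (y + n - x) %% n.

Definition is_side (e : {set 'I_n}) : bool := [exists x, e == [set x; ordS x]].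
Definition is_diag (e : {set 'I_n}) : bool := (#|e| == 2) && ~~ is_side e.

Definition crossing (d1 d2 : {set 'I_n}) : bool :=
  [exists a, exists b, exists c, exists e,
    [&& d1 == [set a; b], d2 == [set c; e], 0 < cdist a c,
        cdist a c < cdist a b & cdist a b < cdist a e]].

Definition triangulation (s : {set {set 'I_n}}) : Prop :=
  [/\ forall d, d \in s -> is_diag d,
      forall d1 d2, d1 \in s -> d2 \in s -> ~~ crossing d1 d2 &
      forall d, is_diag d -> d \notin s -> exists2 d', d' \in s & crossing d d'].

(* arrows: inl (x,y,z) = internal arrow {x,y} -> {x,z} around x;
           inr x       = external arrow {x-1,x} -> {x,x+1} at x *)
Definition arrow := ('I_n * 'I_n * 'I_n + 'I_n)%type.

Definition asrc (a : arrow) : {set 'I_n} :=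
  match a with inl (x, y, z) => [set x; y] | inr x => [set ord_pred x; x] end.
Definition atgt (a : arrow) : {set 'I_n} :=
  match a with inl (x, y, z) => [set x; z] | inr x => [set x; ordS x] end.

Definition theta (a : arrow) : nat :=
  match a with inl (x, y, z) => cdist y z | inr _ => 2 end.

Definition theta_len (p : seq arrow) : nat := \sum_(a <- p) theta a.

Definition cpow (c : seq arrow) (N : nat) : seq arrow := flatten (nseq N c).

Section Triangulation.
Variable s : {set {set 'I_n}}.

(* vertices of Q_sigma: sides of P and diagonals of sigma *)
Definition is_edge (e : {set 'I_n}) : bool := is_side e || (e \in s).

Definition is_triangle (x y z : 'I_n) : bool :=
  [&& x != y, y != z, x != z, is_edge [set x; y], is_edge [set y; z]
    & is_edge [set x; z]].

Definition has_diag (x : 'I_n) : bool := [exists d in s, x \in d].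

Definition valid_arrow (a : arrow) : bool :=
  match a with
  | inl (x, y, z) => is_triangle x y z && (cdist x y < cdist x z)
  | inr x => has_diag x
  end.

Fixpoint is_qpath_from (v : {set 'I_n}) (p : seq arrow) : bool :=
  match p with
  | [::] => true
  | a :: p' => [&& valid_arrow a, asrc a == v & is_qpath_from (atgt a) p']
  end.

Definition qpath (i j : {set 'I_n}) (p : seq arrow) : bool :=
  [&& is_edge i, is_qpath_from i p & last i (map atgt p) == j].

Definition tri_word (x y z : 'I_n) : seq arrow :=
  [:: inl (x, y, z); inl (z, x, y); inl (y, z, x)].

Definition cyc_triangles : seq (seq arrow) :=
  [seq tri_word t.1.1 t.1.2 t.2 |
     t <- enum [pred t : 'I_n * 'I_n * 'I_n |
                 (t.1.1 < t.1.2 < t.2)%N && is_triangle t.1.1 t.1.2 t.2]].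

Definition nbrs (x : 'I_n) : seq 'I_n :=
  sort (fun a b : 'I_n => cdist x a <= cdist x b)
       [seq y <- enum 'I_n | (y != x) && is_edge [set x; y]].

Definition big_cycle (x : 'I_n) : seq arrow :=
  inr x :: [seq inl (x, p.1, p.2) | p <- zip (nbrs x) (behead (nbrs x))].

Definition big_cycles : seq (seq arrow) :=
  [seq big_cycle x | x <- enum 'I_n & has_diag x].

Definition min_cycles : seq (seq arrow) := cyc_triangles ++ big_cycles.

Definition mincycle_at (j : {set 'I_n}) (c : seq arrow) : bool :=
  has (fun w => has (fun k => rot k w == c) (iota 0 (size w))) min_cycles
  && qpath j j c.

Definition cder (a : arrow) (w : seq arrow) : seq (seq arrow) :=
  [seq drop i.+1 w ++ take i w | i <- iota 0 (size w) & nth a w i == a].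

Section Algebra.
Variable K : fieldType.

Definition potential : seq (K * seq arrow) :=
  ([seq (1, w) | w <- cyc_triangles] ++ [seq (-1, w) | w <- big_cycles])%R.

(* cyclic derivative of W_sigma with respect to a: paths from atgt a to asrc a *)
Definition dW (a : arrow) : seq (K * seq arrow) :=
  [seq (cw.1, m) | cw <- potential, m <- cder a cw.2].

(* arrows whose source or target is not frozen *)
Definition rel_arrow (a : arrow) : bool :=
  valid_arrow a && ~~ (is_side (asrc a) && is_side (atgt a)).

(* elements of K Q_sigma: coefficient of each path (start vertex, arrows) *)
Definition qelt := ({set 'I_n} * seq arrow)%type -> K.

(* a generator term  c * u * (d_a W) * v  of the ideal J *)
Record jterm := JTerm {
  jc : K; ju_start : {set 'I_n}; ju : seq arrow; ja : arrow; jv : seq arrow }.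

Definition jterm_ok (t : jterm) : bool :=
  [&& rel_arrow (ja t), qpath (ju_start t) (atgt (ja t)) (ju t)
    & is_qpath_from (asrc (ja t)) (jv t)].

Definition jterm_coef (t : jterm) (w : {set 'I_n} * seq arrow) : K :=
  (jc t * \sum_(dm <- dW (ja t))
           dm.1 * (w == (ju_start t, ju t ++ dm.2 ++ jv t))%:R)%R.

Definition in_J (f : qelt) : Prop :=
  exists L : seq jterm, all jterm_ok L /\
    forall w, f w = (\sum_(t <- L) jterm_coef t w)%R.

Definition eqGamma (i : {set 'I_n}) (p q : seq arrow) : Prop :=
  in_J (fun w => (w == (i, p))%:R - (w == (i, q))%:R)%R.

End Algebra.
End Triangulation.
End Polygon.

(* Main.v *)
Require Import Defs.
From HB Require Import structures.
From mathcomp Require Import all_boot all_order all_algebra.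
From mathcomp Require Import zify.
Import Order.TTheory GRing.Theory Num.Theory.

Set Implicit Arguments.
Unset Strict Implicit.
Unset Printing Implicit Defensive.

(** Number the vertices of the universal cover of the polygon by the naturals
and lift an edge to the pairs (a, b) with a < b < a + n. Swapping (a, b) to
(b, a + n) gives the next lift of the same edge, and corresponds to
multiplication by C. An arrow turns an edge around one of its two ends: it
increases the lift coordinatewise, and its theta-length is the increase of
a + b. So a path from (a, b) to (c, d) exists exactly when a <= c and b <= d,
and its theta-length is c + d - (a + b). Two such paths agree modulo J: when
they leave (a, b) around different ends, the relation for the arrow entering
(a, b) around one end identifies two paths starting with the same two arrows,
and one of the two relations applies because the edge {c, d} does not cross
{a, b}. Hence the shortest path leads to the first lift of j above a lift of
i, and every other path differs from it by a power of C. *)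

(** * Two-element sets, cyclic derivatives of words and cyclic distance *)

Lemma eq_set2 (T : finType) (x y a b : T) :
  [set x; y] = [set a; b] -> (x = a /\ y = b) \/ (x = b /\ y = a).
Proof.
move=> eq_xy.
have: x \in [set a; b] by rewrite -eq_xy set21.
have: y \in [set a; b] by rewrite -eq_xy set22.
have: a \in [set x; y] by rewrite eq_xy set21.
have: b \in [set x; y] by rewrite eq_xy set22.
rewrite !inE => /orP[]/eqP ? /orP[]/eqP ? /orP[]/eqP ? /orP[]/eqP ?;
  subst; by [left | right].
Qed.

Lemma cder_notin n (w : arrow n) p : w \notin p -> cder w p = [::].
Proof.
move=> w_p; rewrite /cder (@eq_in_filter _ _ pred0) ?filter_pred0 // => k.
rewrite mem_iota => /andP[_ lt_k]; apply: contraNF w_p => /eqP <-.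
exact: mem_nth.
Qed.

(** No cycle of the potential repeats an arrow, so together with [cder_notin] this computes the
    cyclic derivatives used below. *)
Lemma cder_uniq n (w : arrow n) p q :
  w \notin p -> w \notin q -> cder w (p ++ w :: q) = [:: q ++ p].
Proof.
move=> w_p w_q; rewrite /cder size_cat iotaD filter_cat add0n.
rewrite (@eq_in_filter _ _ pred0) ?filter_pred0 => [|k]; last first.
  rewrite mem_iota => /andP[_ lt_k]; rewrite nth_cat lt_k.
  by apply: contraNF w_p => /eqP <-; apply: mem_nth.
rewrite /= nth_cat ltnn subnn eqxx (@eq_in_filter _ _ pred0) => [|k]; last first.
  rewrite mem_iota => /andP[lt_k k_lt]; rewrite nth_cat ltnNge ltnW //=.
  rewrite -[k - _]prednK ?subn_gt0 // -subnS /=.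
  by apply: contraNF w_q => /eqP <-; apply: mem_nth; rewrite ltn_subLR.
by rewrite filter_pred0 /= -cat_rcons drop_size_cat ?size_rcons // cat_rcons take_size_cat.
Qed.

Lemma mem_tri_word n (x y z x' y' z' : 'I_n) :
  (inl (x, y, z) : arrow n) \in tri_word x' y' z' ->
  [\/ [/\ x = x', y = y' & z = z'], [/\ x = z', y = x' & z = y'] |
     [/\ x = y', y = z' & z = x']].
Proof.
by rewrite !inE => /or3P[] /eqP[-> -> ->];
  [constructor 1|constructor 2|constructor 3].
Qed.

Lemma cdistE n (x y : 'I_n) : cdist x y = if x <= y then y - x else y + n - x.
Proof.
have := ltn_ord x; have := ltn_ord y; rewrite /cdist => yn xn.
case: leqP => xy; last by rewrite modn_small //; lia.
by rewrite (_ : y + n - x = y - x + n) ?modnDr ?modn_small; lia.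
Qed.

(** * Equality modulo J and the relations given by internal arrows *)

Section Ideal.
Variables (n : nat) (s : {set {set 'I_n}}) (K : fieldType).
Implicit Types (a : arrow n) (i : {set 'I_n}) (p q u v w : seq (arrow n)).

Lemma eqGamma_refl i p : eqGamma s K i p p.
Proof. by exists [::]; split=> // w; rewrite big_nil subrr. Qed.

Lemma eqGamma_sym i p q : eqGamma s K i p q -> eqGamma s K i q p.
Proof.
case=> L [okL eqL].
exists [seq JTerm (- jc t)%R (ju_start t) (ju t) (ja t) (jv t) | t <- L].
split; first by rewrite all_map; apply: sub_all okL => -[].
move=> w; rewrite big_map -opprB eqL -sumrN; apply: eq_bigr => t _.
by rewrite /jterm_coef /= mulNr.
Qed.

Lemma eqGamma_trans i p q u :
  eqGamma s K i p q -> eqGamma s K i q u -> eqGamma s K i p u.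
Proof.
move=> [L1 [ok1 eq1]] [L2 [ok2 eq2]]; exists (L1 ++ L2).
split; first by rewrite all_cat ok1.
by move=> w; rewrite big_cat -eq1 -eq2 /= addrA subrK.
Qed.

(** An internal arrow determines its triangle, and each triangle is listed once, with increasing
    vertices; hence a single summand survives. Later [F m] tests whether a fixed path is [m] placed
    between two given paths. *)
Lemma sum_cyc_triangles (F : seq (arrow n) -> K) x y z :
  valid_arrow s (inl (x, y, z)) ->
  (\sum_(w <- cyc_triangles s) \sum_(m <- cder (inl (x, y, z)) w) F m =
   F [:: inl (z, x, y); inl (y, z, x)])%R.
Proof.
case/andP=> tri_xyz lt_xyz.
rewrite big_map big_enum /=.
have tri_yzx : is_triangle s y z x.
  case/and5P: (tri_xyz) => nxy nyz nxz exy /andP[eyz exz].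
  by rewrite /is_triangle nyz (eq_sym z) nxz (eq_sym y) nxy eyz setUC exz setUC exy.
have tri_zxy : is_triangle s z x y.
  case/and5P: (tri_xyz) => nxy nyz nxz exy /andP[eyz exz].
  by rewrite /is_triangle (eq_sym z) nxz nxy (eq_sym z) nyz setUC exz exy setUC eyz.
have [nyx nzy nzx] : [/\ nat_of_ord y <> x, nat_of_ord z <> y & nat_of_ord z <> x].
  by case/and5P: tri_xyz => /eqP nxy /eqP nyz /eqP nxz _ _; split=> /val_inj; auto.
have [t [tP t_in t_eq]] : exists t : 'I_n * 'I_n * 'I_n,
  [/\ (t.1.1 < t.1.2 < t.2) && is_triangle s t.1.1 t.1.2 t.2,
      inl (x, y, z) \in tri_word t.1.1 t.1.2 t.2 &
      cder (inl (x, y, z)) (tri_word t.1.1 t.1.2 t.2) =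
        [:: [:: inl (z, x, y); inl (y, z, x)]]].
  move: lt_xyz (ltn_ord x) (ltn_ord y) (ltn_ord z); rewrite !cdistE => lt_xyz ? ? ?.
  have [nxy nyz nxz] : [/\ x != y, y != z & x != z] by case/and5P: tri_xyz.
  have ne1 : (inl (x, y, z) : arrow n) != inl (z, x, y).
    by apply: contraNneq nxz => -[->].
  have ne2 : (inl (x, y, z) : arrow n) != inl (y, z, x).
    by apply: contraNneq nxy => -[->].
  (* The listed word starts at the least of the three vertices. As x, y, z are in counterclockwise
     order, three rotations are possible and the fourth comparison pattern is contradictory. *)
  have [lt_xy|le_yx] := ltnP x y; have [lt_yz|le_zy] := ltnP y z.
  - exists (x, y, z); rewrite /= lt_xy lt_yz tri_xyz mem_head; split=> //.
    by rewrite /tri_word (@cder_uniq _ _ [::]) // !inE !negb_or ne1.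
  - exists (z, x, y); rewrite /= lt_xy tri_zxy !inE eqxx ?orbT; split=> //.
      by move: lt_xyz; do 2 case: ifP; lia.
    by rewrite /tri_word (@cder_uniq _ _ [:: _; _] [::]) // !inE !negb_or ne1.
  - exists (y, z, x); rewrite /= lt_yz tri_yzx !inE eqxx ?orbT; split=> //.
      by move: lt_xyz; do 2 case: ifP; lia.
    by rewrite /tri_word (@cder_uniq _ _ [:: _] [:: _]) // !inE ?ne1 ?ne2.
  - by move: lt_xyz; do 2 case: ifP; lia.
rewrite (bigD1 t) //= t_eq big_seq1 big1 ?addr0 // => t' /andP[t'P nt].
rewrite cder_notin ?big_nil //; apply: contraNN nt => t'_in.
case: t t' tP t'P t_in t'_in {t_eq} => [[t1 t2] t3] [[u1 u2] u3] /=.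
case/andP=> lt_t _ /andP[lt_u _] /mem_tri_word t_in /mem_tri_word u_in.
by case: t_in u_in => -[? ? ?] [] [? ? ?]; subst; rewrite ?eqxx // in lt_u *; move: lt_u => /=; lia.
Qed.

(** The internal arrows of a big cycle all turn around its own vertex, so only the big cycle at [x]
    contributes. *)
Lemma sum_big_cycles (F : seq (arrow n) -> K) x y z p q :
  has_diag s x -> big_cycle s x = p ++ inl (x, y, z) :: q ->
  inl (x, y, z) \notin p -> inl (x, y, z) \notin q ->
  (\sum_(w <- big_cycles s) \sum_(m <- cder (inl (x, y, z)) w) F m =
   F (q ++ p))%R.
Proof.
move=> diag_x eq_x x_p x_q; rewrite big_map big_filter big_enum_cond /=.
rewrite (bigD1 x) //= eq_x cder_uniq // big_seq1 big1 ?addr0 // => t /andP[_ nt].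
rewrite cder_notin ?big_nil // /big_cycle inE /=.
by apply/mapP => -[? _ [eq_xt _ _]]; rewrite eq_xt eqxx in nt.
Qed.

(** The arrow lies on one cyclic triangle and one big cycle, which have opposite signs in the
    potential. Its derivative is thus the difference of what remains of these two cycles, and a
    single generator of J suffices. *)
Lemma eqGamma_rel i u v x y z p q :
  rel_arrow s (inl (x, y, z)) -> has_diag s x ->
  big_cycle s x = p ++ inl (x, y, z) :: q ->
  inl (x, y, z) \notin p -> inl (x, y, z) \notin q ->
  qpath s i [set x; z] u -> is_qpath_from s [set x; y] v ->
  eqGamma s K i (u ++ [:: inl (z, x, y); inl (y, z, x)] ++ v) (u ++ (q ++ p) ++ v).
Proof.
move=> rel_a diag_x eq_x x_p x_q path_u path_v.
exists [:: JTerm 1%R i u (inl (x, y, z)) v]; split; first by rewrite /= andbT; apply/and3P.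
move=> w; rewrite big_seq1 /jterm_coef /= mul1r /dW /potential.
have val_a : valid_arrow s (inl (x, y, z)) by case/andP: rel_a.
pose F m : K := (w == (i, u ++ m ++ v))%:R%R.
rewrite big_allpairs_dep big_cat !(big_map (pair _)) /=.
transitivity (F [:: inl (z, x, y); inl (y, z, x)] - F (q ++ p))%R => //.
rewrite -(sum_cyc_triangles F val_a) -(sum_big_cycles F diag_x eq_x x_p x_q).
congr (_ + _)%R.
  by apply: eq_bigr => ? _; apply: eq_bigr => ? _; rewrite mul1r.
rewrite -sumrN; apply: eq_bigr => ? _.
by rewrite -sumrN; apply: eq_bigr => ? _; rewrite mulN1r.
Qed.

End Ideal.

(** * The covering map from the naturals to the polygon vertices *)

Section Lifts.
Variables (n : nat) (n3 : 3 <= n).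

Definition pi (k : nat) : 'I_n :=
  Ordinal (ltn_pmod k (leq_trans (isT : 0 < 3) n3)).

Lemma pi_ord (x : 'I_n) : pi x = x.
Proof. by apply: val_inj; rewrite /= modn_small. Qed.

Lemma piDn a : pi (a + n) = pi a.
Proof. by apply: val_inj; rewrite /= modnDr. Qed.

Lemma pi_eqP a b :
  pi a = pi b -> exists k, a + k * n = b \/ b + k * n = a.
Proof.
move/(congr1 val) => /= eq_ab.
have [le_ba|/ltnW le_ab] := leqP (b %/ n) (a %/ n).
  exists (a %/ n - b %/ n); right.
  by rewrite {1}(divn_eq b n) addnAC -mulnDl subnKC // -eq_ab -divn_eq.
exists (b %/ n - a %/ n); left.
by rewrite {1}(divn_eq a n) addnAC -mulnDl subnKC // eq_ab -divn_eq.
Qed.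

Lemma pi_inj a b : a < b + n -> b < a + n -> pi a = pi b -> a = b.
Proof.
move=> lt_ab lt_ba /pi_eqP[k]; by case: k => [|k] []; rewrite ?mul0n ?mulSn; lia.
Qed.

Lemma pi_neq a b : a < b -> b < a + n -> pi a != pi b.
Proof.
by move=> ab ba; apply/eqP => /pi_inj eq_ab; have := eq_ab; lia.
Qed.

Lemma ordS_pi a : ordS (pi a) = pi a.+1.
Proof. by apply: val_inj; rewrite /= -addn1 modnDml addn1. Qed.

Lemma ord_pred_pi a : ord_pred (pi a.+1) = pi a.
Proof. by rewrite -ordS_pi ordSK. Qed.

Lemma cdist_pi a b : a <= b -> b < a + n -> cdist (pi a) (pi b) = b - a.
Proof.
move=> le_ab lt_ba; rewrite /cdist /=.
have lt_am : a %% n < n by rewrite ltn_mod; lia.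
rewrite -[RHS](@modn_small _ n); last by lia.
apply/eqP; rewrite -(eqn_modDr (a %% n)) subnK; last by lia.
by rewrite modnDmr subnK // modnDr modn_mod.
Qed.

Lemma lift_pi (x : 'I_n) a : exists2 k, a <= k < a + n & pi k = x.
Proof.
have lt_am : a %% n < n by rewrite ltn_mod; lia.
exists (a + cdist (pi a) x).
  by rewrite leq_addr ltn_add2l /cdist ltn_mod; lia.
apply: val_inj; rewrite /= /cdist /= modnDmr -modnDml.
have -> : a %% n + (x + n - a %% n) = x + n by lia.
by rewrite modnDr modn_small.
Qed.

Lemma is_side_piS a : is_side [set pi a; pi a.+1].
Proof. by apply/existsP; exists (pi a); rewrite ordS_pi. Qed.

Lemma is_side_pi a b : a < b -> b < a + n -> is_side [set pi a; pi b] ->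
  b = a.+1 \/ b.+1 = a + n.
Proof.
move=> lt_ab lt_ba /existsP[x /eqP] /eq_set2[[<-]|[eq_a eq_b]].
  by rewrite ordS_pi => /pi_inj eq_b; left; apply: eq_b; lia.
right; apply: pi_inj; rewrite ?piDn ?eq_a -?eq_b ?ordS_pi //; lia.
Qed.

(** * Lifted edges: crossings, maximality and triangles *)

Variables (s : {set {set 'I_n}}) (tri_s : triangulation s).

Definition E a b := [&& a < b, b < a + n & is_edge s [set pi a; pi b]].

Lemma E_lt a b : E a b -> a < b. Proof. by case/and3P. Qed.
Lemma E_ltn a b : E a b -> b < a + n. Proof. by case/and3P. Qed.
Lemma E_edge a b : E a b -> is_edge s [set pi a; pi b].
Proof. by case/and3P. Qed.

Lemma E_side a : E a a.+1.
Proof. by rewrite /E ltnSn /is_edge is_side_piS; lia. Qed.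

Lemma E_swap a b : E a b -> E b (a + n).
Proof. by case/and3P=> ? ? ?; rewrite /E piDn setUC; apply/and3P; split=> //; lia. Qed.

Lemma E_unswap a b : E b (a + n) -> E a b.
Proof. by case/and3P=> ? ? ; rewrite piDn setUC => ?; apply/and3P; split=> //; lia. Qed.

Lemma E_shift a b : E (a + n) (b + n) = E a b.
Proof. by apply/idP/idP=> [/E_unswap /E_unswap|/E_swap /E_swap]. Qed.

Lemma E_last a : E a (a + n).-1.
Proof. by apply: E_unswap; rewrite -{2}[a + n]prednK ?E_side; lia. Qed.

Lemma E_diag a b : E a b -> b != a.+1 -> b.+1 != a + n ->
  [set pi a; pi b] \in s.
Proof.
case/and3P=> lt_ab lt_ba /orP[/is_side_pi side|//].
by case: side => // ->; rewrite eqxx.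
Qed.

Lemma E_noncross a b c d : E a c -> E b d -> a < b -> b < c -> c < d ->
  d < a + n -> False.
Proof.
move=> Eac Ebd ab bc cd da.
have s1 : [set pi a; pi c] \in s by apply: E_diag; move: Eac => //; lia.
have s2 : [set pi b; pi d] \in s by apply: E_diag; move: Ebd => //; lia.
case: tri_s => _ /(_ _ _ s1 s2)/negP + _; apply.
apply/existsP; exists (pi a); apply/existsP; exists (pi c).
apply/existsP; exists (pi b); apply/existsP; exists (pi d).
by rewrite !eqxx /= !cdist_pi; lia.
Qed.

Lemma E_max a b : a < b -> b < a + n -> ~~ E a b ->
  exists c d, [/\ E c d, a < c, c < b, b < d & d < a + n].
Proof.
move=> ab ba nE.
have /norP[nside ns] : ~~ is_edge s [set pi a; pi b] by move: nE; rewrite /E ab ba.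
have diag : is_diag [set pi a; pi b].
  rewrite /is_diag nside cards2 andbT.
  by rewrite pi_neq.
case: tri_s => _ _ /(_ _ diag ns)[d' sd' /existsP[x /existsP[y]]].
case/existsP=> [u /existsP[v /and5P[/eqP eq1 /eqP eq2]]].
have aux p q : p < q -> q < p + n -> pi p = x -> pi q = y ->
  0 < cdist x u -> cdist x u < cdist x y -> cdist x y < cdist x v ->
  exists c d, [/\ E c d, p < c, c < q, q < d & d < p + n].
- move=> pq qp eqx eqy.
  have [k /andP[pk kp] eqk] := lift_pi u p.
  have [l /andP[pl lp] eql] := lift_pi v p.
  rewrite -eqx -eqy -eqk -eql !cdist_pi; try lia.
  move=> ? ? ?; exists k, l; split; try lia.
  by rewrite /E /is_edge eqk eql -eq2 sd' orbT; lia.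
case/eq_set2: eq1 => [[eqa eqb]|[eqa eqb]].
  exact: aux.
(* [crossing] may name the ends of the diagonal in the other order. The argument then runs from the
   lift (b, a + n), and the end of the crossing edge beyond a + n is moved back by n. *)
move=> c1 c2 c3.
have [|||c [d [Ecd bc ca ad db]]] := aux b (a + n) _ _ eqb _ c1 c2 c3.
- lia.
- lia.
- by rewrite piDn.
exists (d - n), c; split; try lia.
apply: E_unswap; rewrite subnK; [exact: Ecd|lia].
Qed.

(** The apex is the last neighbour c of a before b. An edge crossing (c, b) would cross (a, b) or
    (a, c), or would join a to a vertex strictly between c and b. *)
Lemma E_triangle a b : E a b -> b != a.+1 ->
  exists c, [/\ a < c, c < b, E a c & E c b].
Proof.
move=> Eab nb; have ab := E_lt Eab; have ba := E_ltn Eab.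
have exc : exists c, [&& a < c, c < b & E a c].
  by exists a.+1; rewrite E_side; lia.
have ubc c : [&& a < c, c < b & E a c] -> c <= b by lia.
case: (ex_maxnP exc ubc) => c /and3P[ac cb Eac] maxc.
exists c; split=> //; apply: contraT => nEcb.
have [||e [f [Eef ce eb bf fc]]] := E_max _ _ nEcb; try lia.
have [fa|] := ltnP f (a + n); first by case: (E_noncross Eab Eef); lia.
rewrite leq_eqVlt => /orP[/eqP eqf|af].
  have Eae : E a e by apply: E_unswap; rewrite eqf.
  by have := maxc e; rewrite Eae; lia.
case: (@E_noncross a (f - n) c e); try lia => //.
by apply: E_unswap; rewrite subnK //; lia.
Qed.

(** If d < d', the edges (b, d') and (d, a + n) would cross. *)
Lemma apex_uniq a b d d' : E a b -> E a d -> E b d -> E a d' -> E b d' ->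
  b < d -> b < d' -> d < a + n -> d' < a + n -> d = d'.
Proof.
move=> Eab Ead Ebd Ead' Ebd' bd bd' da da'; have ab := E_lt Eab.
have [lt|lt|//] := ltngtP d d'.
  by case: (E_noncross Ebd' (E_swap Ead)); lia.
by case: (E_noncross Ebd (E_swap Ead')); lia.
Qed.

(** * Lifted arrows *)

(** Arrows around the end a of the lift (a, b). [TurnIn] moves the other end to the apex of the
    triangle beyond b. [TurnOut] goes from the last side (a, a + n - 1) at a to the first one, whose
    next lift is (a + 1, a + n); the coordinate sum grows by 2, the length of an external arrow. *)
Inductive turn a b : arrow n -> nat -> nat -> Prop :=
| TurnIn d of b < d & d < a + n & E a b & E a d & E b d :
    turn a b (inl (pi a, pi b, pi d)) a d
| TurnOut of b.+1 = a + n & has_diag s (pi a) :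
    turn a b (inr (pi a)) a.+1 (a + n).

(** Turning around the second end is turning around the first end of the swapped lift (b, a + n). *)
Definition lstep a b w c d := turn a b w c d \/ turn b (a + n) w d (c + n).

Definition apex (w : arrow n) : 'I_n :=
  match w with inl (x, _, _) => x | inr x => x end.

Lemma valid_inl a b d : a < b -> b < d -> d < a + n ->
  valid_arrow s (inl (pi a, pi b, pi d)) = [&& E a b, E a d & E b d].
Proof.
move=> ab bd da; have [ad ba db] : [/\ a < d, b < a + n & d < b + n] by split; lia.
by rewrite /= /is_triangle /E !cdist_pi ?pi_neq; lia.
Qed.

Lemma turn_facts a b w c d : turn a b w c d -> E a b ->
  [/\ valid_arrow s w, asrc w = [set pi a; pi b] & atgt w = [set pi c; pi d]] /\
  [/\ E c d, a <= c, b <= d, a + b + theta w = c + d & a + b < c + d].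
Proof.
case=> [{}d bd da Eab Ead Ebd _|eqb diag Eab].
  have ab := E_lt Eab; split; split=> //; try lia.
    by rewrite valid_inl // Eab Ead.
  by rewrite /= cdist_pi; lia.
have ab := E_lt Eab; split; split=> //=; try lia.
- by rewrite -[pi a]piDn -eqb ord_pred_pi setUC.
- by rewrite ordS_pi piDn setUC.
by have := E_last a.+1; rewrite addSn.
Qed.

Lemma turn_apex a b w c d : turn a b w c d -> apex w = pi a.
Proof. by case. Qed.

Lemma lstep_facts a b w c d : lstep a b w c d -> E a b ->
  [/\ valid_arrow s w, asrc w = [set pi a; pi b] & atgt w = [set pi c; pi d]] /\
  [/\ E c d, a <= c, b <= d, a + b + theta w = c + d & a + b < c + d].
Proof.
case=> [/turn_facts//|/turn_facts turn_w /E_swap /turn_w].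
rewrite !piDn; move=> [[? -> ->] [/E_unswap ? ? ? ? ?]].
rewrite (setUC [set pi a]) (setUC [set pi c]).
by split; split=> //; lia.
Qed.

Lemma turn_shift a b w c d : turn a b w c d -> turn (a + n) (b + n) w (c + n) (d + n).
Proof.
case=> [{}d bd da Eab Ead Ebd|eqb diag].
  rewrite -[pi a]piDn -[pi b]piDn -[pi d]piDn.
  by apply: TurnIn; rewrite ?E_shift //; lia.
by rewrite -[pi a]piDn addSn; apply: TurnOut; rewrite ?piDn //; lia.
Qed.

Lemma turn_unshift a b w c d : turn (a + n) (b + n) w c d ->
  exists c' d', [/\ c = c' + n, d = d' + n & turn a b w c' d'].
Proof.
case=> [{}d bd da Eab Ead Ebd|eqb diag].
  exists a, (d - n); have eqd : d = d - n + n by lia.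
  move: Eab Ead Ebd; rewrite {1 2 3}eqd !E_shift => Eab Ead Ebd; split=> //.
  by rewrite !piDn eqd piDn addnK; apply: TurnIn => //; lia.
exists a.+1, (a + n); split=> //.
by move: diag; rewrite !piDn => diag; apply: TurnOut => //; lia.
Qed.

Lemma lstep_swap a b w c d : lstep a b w c d -> lstep b (a + n) w d (c + n).
Proof. by case=> [/turn_shift|]; [right|left]. Qed.

Lemma lstep_unswap a b w c d : lstep b (a + n) w d c ->
  exists2 c', c = c' + n & lstep a b w c' d.
Proof.
case=> [turn_w|/turn_unshift[c' [d' [-> /addIn<- turn_w]]]].
  have le_c : n <= c by case: turn_w; lia.
  by exists (c - n); rewrite ?subnK //; right; rewrite subnK.
by exists c' => //; left.
Qed.

Lemma lstepP a b w : E a b -> valid_arrow s w -> asrc w = [set pi a; pi b] ->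
  exists c d, lstep a b w c d.
Proof.
have turn_in p q z : E p q -> valid_arrow s (inl (pi p, pi q, z)) ->
    exists2 d, d < p + n & turn p q (inl (pi p, pi q, z)) p d.
  move=> Epq; have pq := E_lt Epq; have qp := E_ltn Epq.
  have [d /andP[pd dp] <-] := lift_pi z p => val_w.
  have qd : q < d by move: val_w => /andP[_]; rewrite !cdist_pi; lia.
  move: val_w; rewrite valid_inl // => /and3P[_ Epd Eqd].
  by exists d => //; apply: TurnIn.
have turn_out p q : E p q -> ord_pred (pi p) = pi q -> has_diag s (pi p) ->
    turn p q (inr (pi p)) p.+1 (p + n).
  move=> Epq; have pq := E_lt Epq; have qp := E_ltn Epq.
  move/(congr1 (@ordS n)); rewrite ord_predK ordS_pi => eq_p diag.
  apply: TurnOut => //.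
  by apply: pi_inj; rewrite ?piDn //; lia.
move=> Eab; have Eba := E_swap Eab.
case: w => [[[x y] z]|x] val_w /eq_set2[[eqx eqy]|[eqx eqy]].
- by move: val_w; rewrite eqx eqy => /(turn_in _ _ _ Eab)[d _ tw]; exists a, d; left.
- move: val_w; rewrite eqx eqy -[pi a]piDn => /(turn_in _ _ _ Eba)[d ltd tw].
  exists (d - n), b; right; rewrite subnK //.
  by case: tw; lia.
- exists b, b.+1; right; rewrite eqy; apply: turn_out; rewrite -?eqy //.
  by rewrite piDn eqx.
by exists a.+1, (a + n); left; rewrite eqy; apply: turn_out; rewrite -?eqy.
Qed.

(** * Lifted paths and their existence between comparable lifts *)

Fixpoint lp a b (p : seq (arrow n)) c d : Prop :=
  if p is w :: p' then exists a' b', lstep a b w a' b' /\ lp a' b' p' c d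
  else a = c /\ b = d.

Lemma lp_cat a b p c d q e f :
  lp a b p c d -> lp c d q e f -> lp a b (p ++ q) e f.
Proof.
elim: p a b => /= [|w p IHp] a b; first by case=> -> ->.
by case=> a' [b' [st /IHp lpq]] /lpq; exists a', b'.
Qed.

Lemma lp_swap a b p c d : lp a b p c d -> lp b (a + n) p d (c + n).
Proof.
elim: p a b => /= [|w p IHp] a b; first by case=> -> ->.
by case=> a' [b' [/lstep_swap st /IHp lpp]]; exists b', (a' + n).
Qed.

Lemma lp_facts a b p c d : E a b -> lp a b p c d ->
  [/\ E c d, a <= c, b <= d & a + b + theta_len p = c + d] /\
  (is_qpath_from s [set pi a; pi b] p /\
   last [set pi a; pi b] (map (@atgt n) p) = [set pi c; pi d]).
Proof.
rewrite /theta_len.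
elim: p a b => /= [|w p IHp] a b Eab.
  by case=> <- <-; rewrite big_nil; do 2 split=> //; lia.
case=> a' [b' [/lstep_facts/(_ Eab)[[-> -> ->] [Ea'b' ? ? ? ?]]]].
move=> /(IHp _ _ Ea'b')[[Ecd ? ? ?] [-> ->]].
by rewrite big_cons eqxx; do 2 split=> //; lia.
Qed.

Lemma lp_qpath a b p c d : E a b -> lp a b p c d ->
  qpath s [set pi a; pi b] [set pi c; pi d] p.
Proof. by move=> Eab /(lp_facts Eab)[_ [pathp lastp]]; rewrite /qpath (E_edge Eab) pathp lastp /=. Qed.

Lemma lpP a b p j : E a b -> qpath s [set pi a; pi b] j p ->
  exists c d, lp a b p c d /\ j = [set pi c; pi d].
Proof.
move=> Eab /and3P[_ pathp /eqP <-].
elim: p a b Eab pathp => /= [|w p IHp] a b Eab; first by exists a, b.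
case/and3P=> val_w /eqP src_w pathp.
have [a' [b' st]] := lstepP Eab val_w src_w.
have [[_ _ eq_tgt] [Ea'b' _ _ _ _]] := lstep_facts st Eab.
rewrite eq_tgt in pathp *.
have [c [d [lpp eq_j]]] := IHp _ _ Ea'b' pathp.
by exists c, d; split=> //; exists a', b'.
Qed.

(** Turn around a to the apex d0 of the outer triangle, unless d < d0. In that case a < c, as
    otherwise (c, d) crosses (b, d0), and turning around b stays below (c, d): if the inner apex c0
    exceeded c, then (c, d) would cross (a, c0). *)
Lemma lstep_ex_half a b c d : E a b -> E c d -> a <= c -> b <= d ->
  a + b < c + d -> b.+1 < a + n ->
  exists w a' b', [/\ lstep a b w a' b', a' <= c & b' <= d].
Proof.
move=> Eab Ecd ac bd lt_sum ba; have ab := E_lt Eab; have Eba := E_swap Eab.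
have [|d0 [bd0 d0a Ebd0 /E_unswap Ead0]] := E_triangle Eba; first by lia.
have [d0d|dd0] := leqP d0 d.
  by exists (inl (pi a, pi b, pi d0)), a, d0; split=> //; left; apply: TurnIn.
have {}ac : a < c.
  rewrite ltn_neqAle ac andbT; apply/eqP=> eq_ac; rewrite -eq_ac in Ecd lt_sum.
  by apply: (E_noncross Ecd Ebd0); lia.
(* If (a, b) is a side, there is no inner triangle; but d < d0 makes (b, d0) a diagonal, so the
   external arrow at b exists. *)
have [eq_b|nb] := eqVneq b a.+1.
  have diag : has_diag s (pi b).
    apply/existsP; exists [set pi b; pi d0]; rewrite set21 andbT.
    by apply: E_diag => //; have := E_lt Ecd; lia.
  exists (inr (pi b)), b, b.+1; split; last 2 first.
  - by rewrite eq_b.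
  - by have := E_lt Ecd; lia.
  by right; apply: TurnOut => //; lia.
have [c0 [ac0 c0b Eac0 Ec0b]] := E_triangle Eab nb.
have [c0c|cc0] := leqP c0 c.
  exists (inl (pi b, pi (a + n), pi (c0 + n))), c0, b; split=> //.
  right; apply: TurnIn => //; try lia; last by rewrite E_shift.
  exact: E_swap.
by case: (E_noncross Eac0 Ecd); lia.
Qed.

Lemma lstep_ex a b c d : E a b -> E c d -> a <= c -> b <= d -> a + b < c + d ->
  exists w a' b', [/\ lstep a b w a' b', a' <= c & b' <= d].
Proof.
move=> Eab Ecd ac bd lt_sum.
(* If b + 1 = a + n, the swapped lift (b, a + n) satisfies the side condition, because n is at least
   3. *)
have [|eq_b] := ltnP b.+1 (a + n); first exact: lstep_ex_half.
have [] := lstep_ex_half (E_swap Eab) (E_swap Ecd); try lia.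
move=> w [a' [_ [/lstep_unswap[b' -> st] ? ?]]].
by exists w, b', a'; split=> //; lia.
Qed.

Lemma lp_ex a b c d : E a b -> E c d -> a <= c -> b <= d ->
  exists p, lp a b p c d.
Proof.
have [m] := ubnP (c + d - (a + b)).
elim: m a b => // m IHm a b le_m Eab Ecd ac bd.
have [lt_sum|ge_sum] := ltnP (a + b) (c + d); last first.
  by exists [::]; split; lia.
have [w [a' [b' [st a'c b'd]]]] := lstep_ex Eab Ecd ac bd lt_sum.
have [_ [Ea'b' _ _ _ ?]] := lstep_facts st Eab.
have [|//|//|//|//|p lpp] := IHm a' b'; first by lia.
by exists (w :: p), a', b'.
Qed.

(** * The lifts of one edge, and cycles of theta-length n *)

Definition swap (p : nat * nat) := (p.2, p.1 + n).

(** Swapping raises the coordinate sum by exactly n, so an edge has only one lift in a window of n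
    consecutive sums. *)
Lemma lift_near a b c d : E a b -> E c d ->
  [set pi a; pi b] = [set pi c; pi d] -> a + b <= c + d -> c + d < a + b + n ->
  a = c /\ b = d.
Proof.
move=> Eab Ecd eq_e ? ?.
have [[[ab ba] cd] dc] := (E_lt Eab, E_ltn Eab, E_lt Ecd, E_ltn Ecd).
case: (eq_set2 eq_e) => -[eq1 eq2]; first by split; apply: pi_inj => //; lia.
have eq_bc : b = c by apply: pi_inj => //; lia.
suff eq_d : a + n = d by lia.
by apply: pi_inj; rewrite ?piDn //; lia.
Qed.

Lemma lift_chain a b c d : E a b -> E c d ->
  [set pi a; pi b] = [set pi c; pi d] -> a + b <= c + d ->
  exists N, (c, d) = iter N swap (a, b).
Proof.
move=> Eab Ecd; have [m] := ubnP (c + d - (a + b)).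
elim: m a b Eab => // m IHm a b Eab le_m eq_e ge_sum.
have [near|far] := ltnP (c + d) (a + b + n).
  by have [-> ->] := lift_near Eab Ecd eq_e ge_sum near; exists 0.
have [||||N eqN] := IHm b (a + n).
- exact: E_swap.
- lia.
- by rewrite piDn setUC.
- lia.
by exists N.+1; rewrite iterSr.
Qed.

Lemma iter_swap_ge N a b : E a b ->
  a <= (iter N swap (a, b)).1 /\ b <= (iter N swap (a, b)).2.
Proof.
elim: N a b => // N IHN a b Eab; rewrite iterSr.
by have := IHN _ _ (E_swap Eab); have := E_lt Eab; have := E_ltn Eab; rewrite /swap /=; lia.
Qed.

Lemma lift_lt a b c d : E a b -> E c d ->
  [set pi a; pi b] = [set pi c; pi d] -> a + b < c + d -> b <= c /\ a + n <= d.
Proof.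
move=> Eab Ecd eq_e lt_sum.
have [|N] := lift_chain Eab Ecd eq_e; first by lia.
case: N => [[? ?]|N]; first by lia.
by rewrite iterSr => eqN; have := iter_swap_ge N (E_swap Eab); rewrite -eqN.
Qed.

(** The endpoint is a lift of the same edge with coordinate sum larger by n, hence the swapped lift.
    This is how multiplication by C becomes [swap]. *)
Lemma cycle_lift a b p : E a b -> qpath s [set pi a; pi b] [set pi a; pi b] p ->
  theta_len p = n -> lp a b p b (a + n).
Proof.
move=> Eab /(lpP Eab)[c [d [lpp eq_e]]] len_p.
have [[Ecd ? ? ?] _] := lp_facts Eab lpp.
have eq_ba : [set pi b; pi (a + n)] = [set pi c; pi d] by rewrite piDn setUC.
suff [eqc eqd] : b = c /\ a + n = d by move: lpp; rewrite -eqc -eqd.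
by apply: (lift_near (E_swap Eab) Ecd eq_ba); lia.
Qed.

Lemma cpow_lift N a b p : E a b -> qpath s [set pi a; pi b] [set pi a; pi b] p ->
  theta_len p = n ->
  lp a b (cpow p N) (iter N swap (a, b)).1 (iter N swap (a, b)).2.
Proof.
elim: N a b => // N IHN a b Eab path_p len_p; rewrite iterSr.
apply: lp_cat (cycle_lift Eab path_p len_p) _.
by apply: IHN; rewrite ?piDn 1?setUC //; apply: E_swap.
Qed.

Lemma edge_set2 e : is_edge s e -> exists x y, x != y /\ e = [set x; y].
Proof.
case/orP=> [/existsP[x /eqP->]|s_e].
  exists x, (ordS x); have [k _ <-] := lift_pi x 0.
  by rewrite ordS_pi pi_neq //; lia.
case: tri_s => /(_ _ s_e)/andP[/cards2P[x [y [xy ->]]] _] _ _.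
by exists x, y.
Qed.

Lemma edge_lift e m : is_edge s e ->
  exists a b, [/\ E a b, m <= a & e = [set pi a; pi b]].
Proof.
move=> edge_e; have [x [y [xy eq_e]]] := edge_set2 edge_e.
have [a /andP[ma _] eq_x] := lift_pi x m.
have [b /andP[ab ba] eq_y] := lift_pi y a.
exists a, b; rewrite -eq_x -eq_y in xy eq_e *.
rewrite /E -eq_e edge_e ba andbT; split=> //.
by rewrite andbT ltn_neqAle ab andbT; apply: contraNneq xy => ->.
Qed.

(** * The fan of edges at a polygon vertex and its big cycle *)

Definition lifts a := [seq k <- iota a.+1 n.-1 | E a k].

Lemma mem_lifts a k : (k \in lifts a) = E a k.
Proof.
rewrite mem_filter mem_iota; apply: andb_idr => Eak.
by have := E_lt Eak; have := E_ltn Eak; lia.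
Qed.

Lemma lifts_sorted a : sorted ltn (lifts a).
Proof. exact/sorted_filter/iota_ltn_sorted/ltn_trans. Qed.

Lemma cdist_pi_E a k : E a k -> cdist (pi a) (pi k) = k - a.
Proof. by move=> Eak; rewrite cdist_pi ?(E_ltn Eak) // ltnW ?(E_lt Eak). Qed.

(** Both lists have the same members and are sorted by distance from a, which separates the
    vertices. *)
Lemma nbrs_pi a : nbrs s (pi a) = map pi (lifts a).
Proof.
apply: (@sorted_eq _ (fun x y => cdist (pi a) x <= cdist (pi a) y)).
- by move=> y x z; apply: leq_trans.
- move=> x y; rewrite -eqn_leq.
  have [k /andP[ak ka] <-] := lift_pi x a; have [l /andP[al la] <-] := lift_pi y a.
  by rewrite !cdist_pi // => /eqP eq_kl; congr pi; lia.
- by apply: sort_sorted => x y; apply: leq_total.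
- rewrite sorted_map; apply: sub_in_sorted (lifts_sorted a) => // k l.
  rewrite !mem_lifts /= => Eak Eal; rewrite !cdist_pi_E // => kl; lia.
apply: uniq_perm.
- by rewrite sort_uniq filter_uniq // enum_uniq.
- rewrite map_inj_in_uniq ?filter_uniq ?iota_uniq // => k l.
  rewrite !mem_lifts => Eak Eal; apply: pi_inj.
    by have := E_ltn Eak; have := E_lt Eal; lia.
  by have := E_ltn Eal; have := E_lt Eak; lia.
move=> x; rewrite mem_sort mem_filter mem_enum andbT.
have [k /andP[ak ka] <-] := lift_pi x a.
apply/andP/mapP => [[nka edge]|[l]].
  exists k => //; rewrite mem_lifts /E edge ka ltn_neqAle ak !andbT.
  by apply: contraNneq nka => ->.
rewrite mem_lifts => Eal ->; rewrite (E_edge Eal) eq_sym pi_neq //.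
  exact: E_lt Eal.
exact: E_ltn Eal.
Qed.

Definition adj a k l := [&& k < l, E a k, E a l & E k l].

(** For consecutive neighbours k < l of a, the inner apex of (a, l) is a neighbour of a before l. It
    cannot precede k, since its edge to l would cross (a, k), so it is k. *)
Lemma lifts_adj a : sorted (adj a) (lifts a).
Proof.
apply/(sortedP 0) => i lt_i; have sorted_l := lifts_sorted a.
have mem_i : nth 0 (lifts a) i \in lifts a by rewrite mem_nth // ltnW.
have mem_i1 : nth 0 (lifts a) i.+1 \in lifts a by rewrite mem_nth.
have := mem_i; have := mem_i1; rewrite !mem_lifts /adj => Eal Eak.
have kl : nth 0 (lifts a) i < nth 0 (lifts a) i.+1 by move/(sortedP 0)/(_ i lt_i): sorted_l.
rewrite Eak Eal kl /=.
have [|c [ac cl Eac Ecl]] := E_triangle Eal; first by have := E_lt Eak; lia.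
have [ck|kc|<- //] := ltngtP c (nth 0 (lifts a) i).
  by case: (E_noncross Eak Ecl); have := E_ltn Eal; lia.
have mem_c : c \in lifts a by rewrite mem_lifts.
have nth_le := sorted_leq_nth leq_trans leqnn 0 (sub_sorted ltnW sorted_l).
have lt_c : index c (lifts a) < size (lifts a) by rewrite index_mem.
move: kc cl; rewrite -(nth_index 0 mem_c) => kc cl.
have [le_ci|lt_ic] := leqP (index c (lifts a)) i.
  by have := leq_ltn_trans (nth_le _ _ lt_c (ltnW lt_i) le_ci) kc; rewrite ltnn.
by have := leq_ltn_trans (nth_le _ _ lt_i lt_c lt_ic) cl; rewrite ltnn.
Qed.

Lemma lifts_head a : exists l, lifts a = a.+1 :: l.
Proof.
rewrite /lifts (_ : n.-1 = n.-2.+1); last by lia.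
by rewrite /= E_side; exists [seq k <- iota a.+2 n.-2 | E a k].
Qed.

Lemma lifts_last a k : last k (lifts a) = (a + n).-1.
Proof.
rewrite /lifts (_ : n.-1 = n.-2 + 1); last by lia.
rewrite iotaD filter_cat last_cat /= (_ : a.+1 + _ = (a + n).-1); last by lia.
by rewrite E_last.
Qed.

Definition steps (x : 'I_n) (l : seq 'I_n) : seq (arrow n) :=
  [seq inl (x, p.1, p.2) | p <- zip l (behead l)].

Lemma steps_cat x l y z m : steps x (l ++ y :: z :: m) =
  steps x (rcons l y) ++ inl (x, y, z) :: steps x (z :: m).
Proof. by elim: l => // u [|v l] //= IHl; rewrite [RHS]/= -[in RHS]IHl. Qed.

Lemma steps_uniq x l : uniq l -> uniq (steps x l).
Proof.
by move=> uniq_l; rewrite map_inj_uniq ?zip_uniql // => -[y z] [y' z'] /= [-> ->].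
Qed.

Lemma steps_lp a k l : path (adj a) k l ->
  lp a k (steps (pi a) (map pi (k :: l))) a (last k l).
Proof.
elim: l k => // k' l IHl k /= /andP[/and4P[kk' Eak Eak' Ekk'] /IHl lpl].
exists a, k'; split=> //; left; apply: TurnIn => //; exact: E_ltn.
Qed.

(** The fan lifts to a path from (a, a + 1) to (a, a + n - 1). The external arrow will supply the
    missing 2. *)
Lemma theta_steps a : theta_len (steps (pi a) (nbrs s (pi a))) = n - 2.
Proof.
rewrite nbrs_pi; have := lifts_adj a; have := lifts_last a 0.
have [l ->] := lifts_head a => /= last_l /steps_lp/(lp_facts (E_side a))[[_ _ _]].
rewrite last_l -[pi a.+1 :: _]/(map pi (a.+1 :: l)) => eq_len _; lia.
Qed.

(** The successor of c in the fan is also an apex over (a, c) on the side of b, so by [apex_uniq] it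
    is b. *)
Lemma triangle_lifts a c b : E a c -> E c b -> E a b ->
  exists l m, [/\ lifts a = l ++ c :: b :: m, path (adj a) b m &
    path (adj a) a.+1 (behead (rcons l c))].
Proof.
move=> Eac Ecb Eab; have cb := E_lt Ecb; have ba := E_ltn Eab.
have mem_c : c \in lifts a by rewrite mem_lifts.
have := lifts_last a 0; have := lifts_adj a; have [t] := lifts_head a.
case/splitPr: mem_c => l [|b' m] eq_t; rewrite last_cat /=.
  by move=> _ eq_c; lia.
rewrite -cat_rcons in eq_t *.
have [r eq_r] : exists r, rcons l c = a.+1 :: r.
  by case: (rcons l c) (size_rcons l c) eq_t => // u r _ [-> _]; exists r.
have eq_last : last a.+1 r = c.
  by rewrite -(last_rcons a.+1 l c) eq_r.
rewrite {1}eq_r /= cat_path /= eq_last => /and3P[path_r /and4P[cb' _ Eab' Ecb']].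
have {Eab' Ecb' cb'} <- : b = b'.
  exact: (apex_uniq Eac Eab Ecb Eab' Ecb' cb cb' ba (E_ltn Eab')).
move=> path_m _; exists l, m; rewrite [behead _]/= eq_r; split=> //.
by rewrite -eq_r cat_rcons.
Qed.

(** Without the arrow from (a, c) to (a, b), the big cycle turns around a from (a, b) to the last
    side, crosses to the first side by the external arrow, and turns on to the next lift of (a,
    c). *)
Lemma big_cycle_split a c b : E a c -> E c b -> E a b -> has_diag s (pi a) ->
  exists p q, [/\ big_cycle s (pi a) = p ++ inl (pi a, pi c, pi b) :: q,
    inl (pi a, pi c, pi b) \notin p, inl (pi a, pi c, pi b) \notin q &
    lp a b (q ++ p) c (a + n)].
Proof.
move=> Eac Ecb Eab diag.
have [l [m [eq_lifts path_m path_l]]] := triangle_lifts Eac Ecb Eab.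
pose p := inr (pi a) :: steps (pi a) (map pi (rcons l c)).
pose q := steps (pi a) (map pi (b :: m)).
have eq_cycle : big_cycle s (pi a) = p ++ inl (pi a, pi c, pi b) :: q.
  rewrite /big_cycle -/(steps (pi a) (nbrs s (pi a))) nbrs_pi eq_lifts.
  by rewrite map_cat /= steps_cat -map_rcons.
have uniq_cycle : uniq (big_cycle s (pi a)).
  rewrite /= steps_uniq ?andbT; first by apply/mapP => -[].
  by rewrite sort_uniq filter_uniq // enum_uniq.
exists p, q; split=> //.
- by move: uniq_cycle; rewrite eq_cycle cat_uniq => /and3P[_ /norP[]].
- by move: uniq_cycle; rewrite eq_cycle cat_uniq => /and3P[_ _ /andP[]].
apply: lp_cat (steps_lp path_m) _.
have := lifts_last a 0; rewrite eq_lifts last_cat /= => ->.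
(* The external arrow lands on the swapped lift of (a, a + 1), so the rest of the fan is lifted
   through [lp_swap]. *)
exists a.+1, (a + n); split.
  by left; apply: TurnOut => //; lia.
have [t eq_t] : exists t, rcons l c = a.+1 :: t.
  have [t] := lifts_head a; rewrite eq_lifts -cat_rcons.
  by case: (rcons l c) (size_rcons l c) => // u t' _ [-> _]; exists t'.
have eq_last : last a.+1 t = c by rewrite -(last_rcons a.+1 l c) eq_t.
by move: path_l; rewrite eq_t => /steps_lp/lp_swap; rewrite eq_last -eq_t.
Qed.

(** * Uniqueness modulo J of the path between two lifts *)

Lemma turn_det a b w c d w' c' d' : turn a b w c d -> turn a b w' c' d' ->
  [/\ w = w', c = c' & d = d'].
Proof.
case=> [{}d bd da Eab Ead Ebd|eqb diag] [{}d' bd' da' _ Ead' Ebd'|eqb' _] //; try lia.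
by rewrite (apex_uniq Eab Ead Ebd Ead' Ebd').
Qed.

Lemma lstep_det a b w c d w' c' d' : E a b -> lstep a b w c d ->
  lstep a b w' c' d' -> apex w = apex w' -> [/\ w = w', c = c' & d = d'].
Proof.
move=> Eab; have nab := pi_neq (E_lt Eab) (E_ltn Eab).
case=> turn_w [] turn_w'; rewrite (turn_apex turn_w) (turn_apex turn_w').
- by move=> _; apply: turn_det turn_w'.
- by move=> eq_ab; rewrite eq_ab eqxx in nab.
- by move=> eq_ab; rewrite eq_ab eqxx in nab.
by move=> _; have [-> -> /addIn ->] := turn_det turn_w turn_w'.
Qed.

Lemma lp_unswap a b p c d : lp b (a + n) p d (c + n) -> lp a b p c d.
Proof.
elim: p a b => /= [|w p IHp] a b; first by case=> -> /addIn ->.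
case=> b' [a' [/lstep_unswap[{}a' -> st] /IHp lpp]].
by exists a', b'.
Qed.

Lemma is_qpath_from_cat e p q : is_qpath_from s e (p ++ q) =
  is_qpath_from s e p && is_qpath_from s (last e (map (@atgt n) p)) q.
Proof. by elim: p e => //= w p IHp e; rewrite IHp !andbA. Qed.

Lemma qpath_rcons i e u w : qpath s i e u -> valid_arrow s w -> asrc w = e ->
  qpath s i (atgt w) (rcons u w).
Proof.
case/and3P=> edge_i path_u /eqP last_u val_w src_w.
rewrite /qpath edge_i -cats1 is_qpath_from_cat path_u last_u /= val_w src_w.
by rewrite map_cat last_cat /= !eqxx.
Qed.

Variable K : fieldType.

(* Two paths from the lift (a, b) to the lift (x, y), leaving along the two
   ends of the edge, that agree modulo J in every context. *)
Definition diamond a b x y := E x y /\ exists w B w' T,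
  [/\ lp a b (w :: B) x y, apex w = pi a, lp a b (w' :: T) x y, apex w' = pi b &
   forall i u v, qpath s i [set pi a; pi b] u -> is_qpath_from s [set pi x; pi y] v ->
     eqGamma s K i (u ++ (w :: B) ++ v) (u ++ (w' :: T) ++ v)].

Lemma diamond_swap a b x y : diamond b (a + n) y (x + n) -> diamond a b x y.
Proof.
case=> /E_unswap Exy [w [B [w' [T [/lp_unswap lpB apw /lp_unswap lpT apw' eqBT]]]]].
split=> //; exists w', T, w, B; split=> //; first by rewrite apw' piDn.
move=> i u v path_u path_v; apply: eqGamma_sym.
by apply: eqBT; rewrite piDn setUC.
Qed.

Lemma apex_big_cycle x w : w \in big_cycle s x -> apex w = x.
Proof. by rewrite inE => /orP[/eqP->|/mapP[? _ ->]]. Qed.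

(** If both ends of the arrow were sides, they would be the two sides at a, and the edge (c, b)
    would cut off the vertex a and cross every diagonal there. *)
Lemma has_diag_arrow a c b : E a c -> E c b -> E a b -> has_diag s (pi a) ->
  rel_arrow s (inl (pi a, pi c, pi b)).
Proof.
move=> Eac Ecb Eab diag; have [[ac cb] ba] := (E_lt Eac, E_lt Ecb, E_ltn Eab).
rewrite /rel_arrow valid_inl // Eac Eab Ecb /=.
apply: contraTN diag => /andP[side1 side2].
have {side2} eq_b : b.+1 = a + n.
  by case: (is_side_pi (E_lt Eab) ba side2) => //; lia.
have {side1} eq_c : c = a.+1.
  by case: (is_side_pi ac (E_ltn Eac) side1) => //; lia.
apply/existsP => -[e /andP[s_e a_e]].
have edge_e : is_edge s e by rewrite /is_edge s_e orbT.
have [f Eaf eq_e] : exists2 f, E a f & e = [set pi a; pi f].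
  have [x [y [xy eq_e]]] := edge_set2 edge_e.
  have [z az eq_z] : exists2 z, pi a != z & e = [set pi a; z].
    move: a_e; rewrite eq_e !inE => /orP[]/eqP eq_a.
      by exists y; rewrite eq_a.
    by exists x; rewrite eq_a ?(eq_sym y) // setUC.
  have [f /andP[af fa] eq_f] := lift_pi z a.
  exists f; last by rewrite eq_f.
  rewrite /E eq_f -eq_z edge_e fa !andbT ltn_neqAle af andbT.
  by apply: contraNneq az => ->; rewrite eq_f.
have nside : ~~ is_side e by case: tri_s => /(_ _ s_e)/andP[].
have [af fa] := (E_lt Eaf, E_ltn Eaf).
have nf1 : f != a.+1 by apply: contraNneq nside; rewrite eq_e => ->; apply: is_side_piS.
have nf2 : f.+1 != a + n.
  apply: contraNneq nside => eq_f; rewrite eq_e -[pi a]piDn -eq_f setUC; exact: is_side_piS.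
by case: (E_noncross Eaf Ecb); lia.
Qed.

(** The relation of the arrow from (a, c) to (a, b): the rest of the big cycle leaves (a, b) around
    a, while the rest of the triangle leaves it around b and passes through (c, b). *)
Lemma half_diamond a c b : E a c -> E c b -> E a b -> has_diag s (pi a) ->
  diamond a b c (a + n).
Proof.
move=> Eac Ecb Eab diag; have [[ac cb] ba] := (E_lt Eac, E_lt Ecb, E_ltn Eab).
have [p [q [eq_cycle a_p a_q]]] := big_cycle_split Eac Ecb Eab diag.
case eqB: (q ++ p) => [|w B]; first by case=> eq_ac; lia.
move=> lpB; split; first exact: E_swap.
exists w, B, (inl (pi b, pi a, pi c)), [:: inl (pi c, pi b, pi a)].
have lpT : lp a b [:: inl (pi b, pi a, pi c); inl (pi c, pi b, pi a)] c (a + n).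
  exists c, b; split.
    right; rewrite -[pi a]piDn -[pi c]piDn; apply: TurnIn; rewrite ?E_shift //; try lia.
      exact: E_swap Eab.
    exact: E_swap Ecb.
  exists c, (a + n); split=> //; left; rewrite -[pi a]piDn.
  by apply: TurnIn => //; [lia|exact: E_swap Eac|exact: E_swap Eab].
split=> //.
  apply: apex_big_cycle; rewrite eq_cycle.
  have : w \in q ++ p by rewrite eqB mem_head.
  by rewrite !mem_cat in_cons => /orP[] ->; rewrite ?orbT.
move=> i u v path_u; rewrite piDn setUC => path_v; apply: eqGamma_sym.
rewrite -eqB; apply: eqGamma_rel path_u path_v => //.
exact: has_diag_arrow.
Qed.

(** The relation at b closes a diamond at (b, f), with f the outer apex. If the second step is
    internal, (a, b) is a diagonal and the relation at a gives another diamond, closing at (a2, a +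
    n); were neither top below (c, d), the edges (a, b) and (c, d) would cross. If it is external,
    it already forces b <= c, and (b, f) works. *)
Lemma diamond_ex_half a b w1 a1 b1 w2 a2 b2 c d : E a b -> E c d ->
  turn a b w1 a1 b1 -> turn b (a + n) w2 b2 (a2 + n) ->
  a1 <= c -> b1 <= d -> a2 <= c -> b2 <= d -> b.+1 < a + n ->
  exists x y, [/\ diamond a b x y, x <= c & y <= d].
Proof.
move=> Eab Ecd; have [[ab ba] cd] := (E_lt Eab, E_ltn Eab, E_lt Ecd).
case=> [f bf fa _ Eaf Ebf|]; last by lia.
move eq_e: (a2 + n) => e turn_w2 ac fd a2c b2d ba1.
have right_diamond : has_diag s (pi b) -> diamond a b b f.
  move=> diag; apply: diamond_swap; apply: half_diamond => //.
  - exact: E_swap.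
  - exact: E_swap.
case: turn_w2 eq_e a2c b2d => [e0 ae eb _ Ebe Eae|eq_ab diag] eq_e a2c b2d.
  have {Ebe Eae} [Ea2b Eaa2] : E a2 b /\ E a a2.
    by rewrite -eq_e E_shift in Eae; rewrite -eq_e in Ebe; split=> //; apply: E_unswap.
  have [a_a2 a2b] := (E_lt Eaa2, E_lt Ea2b).
  have s_ab : [set pi a; pi b] \in s by apply: E_diag => //; lia.
  have diag : has_diag s (pi a) && has_diag s (pi b).
    by apply/andP; split; apply/existsP; exists [set pi a; pi b]; rewrite s_ab !inE eqxx ?orbT.
  case/andP: diag => diag_a diag_b.
  have [and|dan] := leqP (a + n) d.
    by exists a2, (a + n); split=> //; apply: half_diamond.
  have [bc|cb] := leqP b c; first by exists b, f; split; auto.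
  by case: (E_noncross Eab Ecd); lia.
exists b, f; split; [exact: right_diamond| lia|lia].
Qed.

Lemma diamond_ex a b w1 a1 b1 w2 a2 b2 c d : E a b -> E c d ->
  turn a b w1 a1 b1 -> turn b (a + n) w2 b2 (a2 + n) ->
  a1 <= c -> b1 <= d -> a2 <= c -> b2 <= d ->
  exists x y, [/\ diamond a b x y, x <= c & y <= d].
Proof.
move=> Eab Ecd turn1 turn2 ac bd ac2 bd2; have [ab ba] := (E_lt Eab, E_ltn Eab).
have [|ba1] := ltnP b.+1 (a + n); first exact: diamond_ex_half turn1 turn2 _ _ _ _.
have [|||||y [x [dia yd xc]]] :=
  diamond_ex_half (E_swap Eab) (E_swap Ecd) turn2 (turn_shift turn1); try lia.
exists (x - n), y; split; try lia.
apply: diamond_swap; rewrite subnK //.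
(* The lifted path in the diamond gives a + n <= x, so x - n is not truncated. *)
case: dia => _ [w [B [_ [_ [/(lp_facts (E_swap Eab))[[_ _ ? _] _] _ _ _ _]]]]]; lia.
Qed.

(** Confluence, by induction on the remaining length. Paths leaving around the same end share their
    first arrow. Otherwise a diamond with top below (c, d), extended by a path to (c, d), gives two
    intermediate paths that are equal modulo J and share their first arrows with p and q
    respectively. *)
Lemma lp_uniq a b p q c d i u : E a b -> lp a b p c d -> lp a b q c d ->
  qpath s i [set pi a; pi b] u -> eqGamma s K i (u ++ p) (u ++ q).
Proof.
have [m] := ubnP (c + d - (a + b)).
elim: m a b p q u => // m IHm a b p q u le_m Eab lpp lpq path_u.
have [[Ecd _ _ len_p] _] := lp_facts Eab lpp.
have [[_ _ _ len_q] _] := lp_facts Eab lpq.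
have same w p' w' q' : lp a b (w :: p') c d -> lp a b (w' :: q') c d ->
    apex w = apex w' -> eqGamma s K i (u ++ w :: p') (u ++ w' :: q').
  move=> [a1 [b1 [st lpp']]] [a2 [b2 [st' lpq']]] /(lstep_det Eab st st').
  move=> [eq_w eq_a eq_b]; subst a2 b2 w'.
  have [[val_w src_w tgt_w] [E1 _ _ _ lt1]] := lstep_facts st Eab.
  have [[_ _ _ len'] _] := lp_facts E1 lpp'.
  (* The common first arrow is moved into the prefix [u]. *)
  rewrite -!cat_rcons; apply: IHm lpp' lpq' _ => //; first by lia.
  by rewrite -tgt_w; apply: qpath_rcons path_u _ _.
case: p lpp len_p => [|w1 p] lpp len_p; case: q lpq len_q => [|w2 q] lpq len_q.
- exact: eqGamma_refl.
- case: lpp lpq => -> -> [a2 [b2 [/lstep_facts/(_ Ecd)[_ [E2 _ _ _ lt2]]]]].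
  by move=> /(lp_facts E2)[[_ ? ?]]; lia.
- case: lpq lpp => -> -> [a2 [b2 [/lstep_facts/(_ Ecd)[_ [E2 _ _ _ lt2]]]]].
  by move=> /(lp_facts E2)[[_ ? ?]]; lia.
have [eq_ap|ne_ap] := eqVneq (apex w1) (apex w2); first exact: same.
have dia_case w p' w' q' : lp a b (w :: p') c d -> lp a b (w' :: q') c d ->
    apex w = pi a -> apex w' = pi b -> eqGamma s K i (u ++ w :: p') (u ++ w' :: q').
  move=> lpw lpw' apw apw'; have nab := pi_neq (E_lt Eab) (E_ltn Eab).
  case: (lpw) (lpw') => a1 [b1 [st lpp']] [a2 [b2 [st' lpq']]].
  have [_ [E1 _ _ _ _]] := lstep_facts st Eab.
  have [_ [E2 _ _ _ _]] := lstep_facts st' Eab.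
  have [[_ ? ? _] _] := lp_facts E1 lpp'.
  have [[_ ? ? _] _] := lp_facts E2 lpq'.
  case: st => [turn1|/turn_apex eq_ap]; last by rewrite -eq_ap apw eqxx in nab.
  case: st' => [/turn_apex eq_ap|turn2]; first by rewrite -eq_ap apw' eqxx in nab.
  have [//|//|//|//|x [y [[Exy [v [B [v' [T [lpB apv lpT apv' eqBT]]]]]] xc yd]]] :=
    diamond_ex Eab Ecd turn1 turn2.
  have [r lpr] := lp_ex Exy Ecd xc yd.
  have [_ [path_r _]] := lp_facts Exy lpr.
  apply: eqGamma_trans (same _ _ _ _ lpw (lp_cat lpB lpr) _) _; first by rewrite apw apv.
  apply: eqGamma_trans (eqBT _ _ _ path_u path_r) _.
  by apply: (same _ _ _ _ (lp_cat lpT lpr) lpw'); rewrite apv' apw'.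
case: (lpp) (lpq) => a1 [b1 [st1 _]] [a2 [b2 [st2 _]]].
move: ne_ap; case: st1 => /turn_apex ap1; case: st2 => /turn_apex ap2; rewrite ap1 ap2 ?eqxx // => _.
  exact: dia_case.
by apply: eqGamma_sym; apply: dia_case.
Qed.

(** * First lifts, shortest paths and frozen vertices *)

Lemma theta_len_perm p q : perm_eq p q -> theta_len p = @theta_len n q.
Proof. by move=> eq_pq; apply: perm_big. Qed.

(** The angles of a triangle add up to n units; the angles of a fan add up to n - 2, plus 2 for the
    external arrow. *)
Lemma theta_mincycle j c : mincycle_at s j c -> theta_len c = n.
Proof.
case/andP=> /hasP[w w_min /hasP[k _ /eqP <-]] _.
rewrite (@theta_len_perm _ w) ?perm_rot //.
move: w_min; rewrite mem_cat => /orP[/mapP[[[x y] z] /=]|/mapP[x]].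
  rewrite mem_enum inE => /andP[/= /andP[xy yz] _] ->.
  have zn := ltn_ord z.
  rewrite /theta_len /tri_word !big_cons big_nil /= !cdistE.
  by rewrite (ltnW xy) (ltnW yz) leqNgt (ltn_trans xy yz) /=; lia.
rewrite mem_filter => /andP[_ _] ->.
rewrite /theta_len /big_cycle big_cons -/(theta_len _) -/(steps x (nbrs s x)).
by rewrite -[x]pi_ord theta_steps /=; lia.
Qed.

(** The lift of an edge preceding (c, d) is (d - n, c); the last conjunct says that it is not above
    (a, b). *)
Definition minlift a b c d :=
  [&& E c d, a <= c, b <= d & ~~ ((a + n <= d) && (b <= c))].

Lemma minlift_ex a b j : E a b -> is_edge s j ->
  exists c d, minlift a b c d /\ j = [set pi c; pi d].
Proof.
move=> Eab /(edge_lift b)[c [d [Ecd bc ->]]].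
have [ac bd] : a <= c /\ b <= d.
  by have := E_lt Eab; have := E_lt Ecd; lia.
have [m] := ubnP (c + d); elim: m c d Ecd ac bd {bc} => // m IHm c d Ecd ac bd le_m.
have [/andP[and bc]|min_cd] := boolP ((a + n <= d) && (b <= c)); last first.
  by exists c, d; rewrite /minlift Ecd ac bd.
have eq_d : d = d - n + n by lia.
have [||||c' [d' [min' eq_j]]] := IHm (d - n) c; try lia.
  by apply: E_unswap; rewrite -eq_d.
by exists c', d'; split=> //; rewrite -eq_j setUC {1}eq_d piDn.
Qed.

(** A lift above (a, b) with smaller sum is at most (d - n, c) in both coordinates, which would put
    that preceding lift above (a, b). *)
Lemma minlift_le a b c d c' d' : minlift a b c d -> E c' d' -> a <= c' -> b <= d' ->
  [set pi c; pi d] = [set pi c'; pi d'] -> c + d <= c' + d'.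
Proof.
case/and4P=> Ecd ac bd min_cd Ecd' ac' bd' eq_e; rewrite leqNgt.
apply/negP => lt_sum; case/negP: min_cd.
by have [] := lift_lt Ecd' Ecd (esym eq_e) lt_sum; lia.
Qed.

Definition shortest i j p := qpath s i j p /\
  forall w, qpath s i j w -> theta_len p <= theta_len w.

Lemma minlift_shortest a b c d p : E a b -> minlift a b c d -> lp a b p c d ->
  shortest [set pi a; pi b] [set pi c; pi d] p.
Proof.
move=> Eab min_cd lpp; split; first exact: lp_qpath.
move=> w /(lpP Eab)[c' [d' [lpw eq_j]]].
have [[_ _ _ lenp] _] := lp_facts Eab lpp.
have [[Ecd' ac' bd' lenw] _] := lp_facts Eab lpw.
by have := minlift_le min_cd Ecd' ac' bd' eq_j; lia.
Qed.

Lemma shortest_theta a b c d p : E a b -> minlift a b c d ->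
  shortest [set pi a; pi b] [set pi c; pi d] p -> a + b + theta_len p = c + d.
Proof.
move=> Eab min_cd [path_p min_p]; have /and4P[Ecd ac bd _] := min_cd.
have [q lpq] := lp_ex Eab Ecd ac bd.
have [path_q min_q] := minlift_shortest Eab min_cd lpq.
have [[_ _ _ lenq] _] := lp_facts Eab lpq.
by have := min_p _ path_q; have := min_q _ path_p; lia.
Qed.

Lemma shortest_ex i j : is_edge s i -> is_edge s j -> exists p, shortest i j p /\
  forall w, qpath s i j w -> exists N, forall c, mincycle_at s j c ->
    eqGamma s K i w (p ++ cpow c N).
Proof.
move=> /(edge_lift 0)[a [b [Eab _ ->]]] edge_j.
have [c [d [min_cd ->]]] := minlift_ex Eab edge_j.
have /and4P[Ecd ac bd _] := min_cd.
have [p lpp] := lp_ex Eab Ecd ac bd.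
exists p; split; first exact: minlift_shortest.
move=> w /(lpP Eab)[c' [d' [lpw eq_j]]].
have [[Ecd' ac' bd' lenw] _] := lp_facts Eab lpw.
(* N counts the swaps from the first lift of j to the lift reached by w, so it serves every minimal
   cycle at j. *)
have [N eqN] := lift_chain Ecd Ecd' eq_j (minlift_le min_cd Ecd' ac' bd' eq_j).
exists N => cyc min_cyc.
have path_cyc : qpath s [set pi c; pi d] [set pi c; pi d] cyc by case/andP: min_cyc.
have := cpow_lift N Ecd path_cyc (theta_mincycle min_cyc); rewrite -eqN => lpc.
have path_nil : qpath s [set pi a; pi b] [set pi a; pi b] [::].
  by rewrite /qpath (E_edge Eab) /=.
exact: (lp_uniq Eab lpw (lp_cat lpp lpc) path_nil).
Qed.

Lemma qpath_cat i j k p q : qpath s i j p -> qpath s j k q -> qpath s i k (p ++ q).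
Proof.
case/and3P=> edge_i path_p /eqP last_p /and3P[_ path_q last_q].
by rewrite /qpath edge_i is_qpath_from_cat path_p last_p path_q map_cat last_cat last_p.
Qed.

Lemma theta_triangle i j k p q r : shortest k j p -> shortest k i q ->
  shortest i j r -> theta_len p <= theta_len q + theta_len r.
Proof.
case=> _ min_p [path_q _] [path_r _]; rewrite /theta_len -big_cat.
exact: min_p (qpath_cat path_q path_r).
Qed.

(* If the lift (a, b) of i has (c, d) as the first lift of j above it, then
   (a, b) and (c, d) are also the first lifts of i and j above one of the
   sides (b + 1 - n, b) and (a, a + 1) of the polygon. *)
Lemma frozen_witness i j : is_edge s i -> is_edge s j ->
  exists2 k, is_side k & forall p q r, shortest k j p -> shortest k i q ->
    shortest i j r -> theta_len p = theta_len q + theta_len r.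
Proof.
(* Lifting i beyond n keeps b + 1 - n from being truncated. *)
move=> /(edge_lift n)[a [b [Eab na ->]]] edge_j.
have [c [d [min_cd ->]]] := minlift_ex Eab edge_j.
have [[[ab ba] /and4P[Ecd ac bd min_cd']]] := (E_lt Eab, E_ltn Eab, min_cd).
have [cd dc] := (E_lt Ecd, E_ltn Ecd).
have side x y : E x y -> is_side [set pi x; pi y] -> minlift x y a b ->
    minlift x y c d -> exists2 k, is_side k & forall p q r,
    shortest k [set pi c; pi d] p -> shortest k [set pi a; pi b] q ->
    shortest [set pi a; pi b] [set pi c; pi d] r ->
    theta_len p = theta_len q + theta_len r.
  move=> Exy side_xy min_ab' min_cd2; exists [set pi x; pi y] => // p q r sp sq sr.
  have := shortest_theta Exy min_cd2 sp; have := shortest_theta Exy min_ab' sq.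
  by have := shortest_theta Eab min_cd sr; lia.
(* If c < b, the lift (d - n, c) is not above (b + 1 - n, b). If b <= c, minimality gives d < a + n,
   so that lift is not above (a, a + 1). *)
have [cb|bc] := ltnP c b.
  have eq_b : b + 1 - n + n = b.+1 by lia.
  have Exb : E (b + 1 - n) b by apply: E_unswap; rewrite eq_b; apply: E_side.
  apply: (side _ _ Exb); last 2 first.
  - by rewrite /minlift Eab; lia.
  - by rewrite /minlift Ecd; lia.
  by rewrite -[pi (_ - _)]piDn eq_b setUC; apply: is_side_piS.
apply: (side _ _ (E_side a) (is_side_piS a)).
  by rewrite /minlift Eab; lia.
by rewrite /minlift Ecd; lia.
Qed.

End Lifts.

(** * Choice of the paths and the maximum over frozen vertices *)

Theorem theorem2p17 (K : fieldType) (n : nat) (s : {set {set 'I_n}}) :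
  (3 <= n)%N -> triangulation s ->
  exists w0 : {set 'I_n} -> {set 'I_n} -> seq (arrow n),
    (forall i j, is_edge s i -> is_edge s j ->
       [/\ qpath s i j (w0 i j),
           (forall w, qpath s i j w -> (theta_len (w0 i j) <= theta_len w)%N) &
           (forall w, qpath s i j w -> exists N : nat,
              forall c, mincycle_at s j c ->
                eqGamma s K i w (w0 i j ++ cpow c N))]) /\
    (forall i j, is_edge s i -> is_edge s j ->
       (forall k, is_side k ->
          (Posz (theta_len (w0 k j)) - Posz (theta_len (w0 k i))
             <= Posz (theta_len (w0 i j)))%R) /\
       (exists2 k, is_side k &
          Posz (theta_len (w0 i j))
            = (Posz (theta_len (w0 k j)) - Posz (theta_len (w0 k i)))%R)).
Proof.
move=> n3 tri_s.
(* The pairs of vertex sets form a finite type, so the paths can be chosen constructively; pairs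
   that are not pairs of edges get the empty path. *)
have w0_ex (e : {set 'I_n} * {set 'I_n}) : exists p, is_edge s e.1 -> is_edge s e.2 ->
    shortest s e.1 e.2 p /\
    forall w, qpath s e.1 e.2 w -> exists N, forall c, mincycle_at s e.2 c ->
      eqGamma s K e.1 w (p ++ cpow c N).
  have [edge1|] := boolP (is_edge s e.1); last by exists [::].
  have [edge2|] := boolP (is_edge s e.2); last by exists [::].
  by have [p pP] := shortest_ex n3 tri_s K edge1 edge2; exists p.
have [f f_spec] := fin_all_exists w0_ex.
exists (fun i j => f (i, j)).
have sh i j : is_edge s i -> is_edge s j -> shortest s i j (f (i, j)).
  by move=> edge_i edge_j; have [] := f_spec (i, j) edge_i edge_j.
have side_edge k : is_side k -> is_edge s k by rewrite /is_edge => ->.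
split=> i j edge_i edge_j.
  by have [[path_p min_p] eq_p] := f_spec (i, j) edge_i edge_j; split.
split=> [k /side_edge edge_k|].
  rewrite lerBlDl -PoszD lez_nat.
  exact: theta_triangle (sh _ _ edge_k edge_j) (sh _ _ edge_k edge_i) (sh _ _ edge_i edge_j).
have [k side_k eq_k] := frozen_witness n3 tri_s edge_i edge_j.
have edge_k := side_edge k side_k; exists k => //.
rewrite (eq_k _ _ _ (sh _ _ edge_k edge_j) (sh _ _ edge_k edge_i) (sh _ _ edge_i edge_j)).
by rewrite PoszD [RHS]addrC addKr.
Qed.
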